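(* Let $b,c \in \mathbb{Z}$. For any positive integer $n$, we have $$\sum_{k=0}^{n-1} (8ck+4c+b)\,T_k(b,c^2)^2\, (b-2c)^{2(n-1-k)} \equiv 0 \pmod{n}.$$ If $p$ is an odd prime not dividing $b(b-2c)$, then $$\sum_{k=0}^{p-1} (8ck+4c+b) \frac{T_k(b,c^2)^2}{(b-2c)^{2k}}\equiv p(b+2c) \left( \frac{b^2-4c^2}{p} \right) \pmod{p^2},$$ where $\left(\frac{\cdot}{p}\right)$ denotes the Legendre symbol.
   Context: For integers $b,c$ and $n\in\{0,1,2,\ldots\}$, the generalized central trinomial coefficient $T_n(b,c)$ is the coefficient of $x^n$ in the expansion of $(x^2+bx+c)^n$; hence $T_k(b,c^2)$ is the coefficient of $x^k$ in $(x^2+bx+c^2)^k$. The convention $0^0=1$ is used. Congruences modulo $p^2$ between rational numbers whose denominators are prime to $p$ are understood in the ring of rational $p$-adic integers, i.e. $x\equiv y \pmod{p^2}$ means that $(x-y)/p^2$ is a rational number with denominator prime to $p$. The Legendre symbol $\left(\frac{a}{p}\right)$ is $0$ when $p\mid a$. *)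

(* Defs.v *)
From mathcomp Require Import all_boot all_order all_algebra.
Set Implicit Arguments.
Unset Strict Implicit.
Unset Printing Implicit Defensive.
Import Order.TTheory GRing.Theory Num.Theory.
Local Open Scope ring_scope.

(* T_n(b, c) *)
Definition gtrinomial (n : nat) (b c : int) : int :=
  (('X^2 + b%:P * 'X + c%:P) ^+ n : {poly int})`_n.

(* Legendre symbol (a / p); only meaningful for p an odd prime. *)
Definition legendre (a : int) (p : nat) : int :=
  if (p %| a)%Z then 0
  else if [exists x : 'I_p, ((x%:Z ^+ 2)%R == a %[mod p])%Z] then 1
  else -1.

(* x = y mod p^e in the ring of rationals with denominator prime to p;
   denq is positive, so the absolute value is just the cast to nat. *)
Definition rat_congr (p e : nat) (x y : rat) : bool :=
  coprime `|denq ((x - y) / (p ^ e)%:R)|%N p.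

(* Main.v *)
Require Import Defs.
From mathcomp Require Import all_boot all_order all_algebra.
From mathcomp Require Import ring finfield.
Set Implicit Arguments.
Unset Strict Implicit.
Unset Printing Implicit Defensive.
Import Order.TTheory GRing.Theory Num.Theory.
Local Open Scope ring_scope.

(* Write q = X^2 + b X + c^2, T_n = [X^n] q^n and B_n = [X^(n+1)] q^n, and let S_n be the
   sum of the first part. The differential equation q (q^n)' = n q' q^n gives first-order
   recurrences for the pair (T_n, B_n), from which induction yields the closed form
     b S_(n+1) = (n+1) (2 b c (n+1) (c B_n - T_n)^2 + (b + 2 c) T_(n+1) T_n).
   Reading this as an identity between polynomials in an indeterminate b and comparing
   coefficients gives n | S_n. For n = p prime it reduces the second part to
   T_p = b and T_(p-1) = ((b^2 - 4 c^2) / p) modulo p. The former is Frobenius; for the latter,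
   summing q(x)^(p-1) over x in F_p gives - (T_(p-1) + 1) by power sums, and minus the number
   of square roots of the discriminant by Fermat after completing the square. *)

(** * Coefficients of powers of a trinomial over a commutative ring *)

Section Trinomial.
Variable R : comNzRingType.
Implicit Types b c : R.

Definition trinom b c : {poly R} := 'X^2 + b%:P * 'X + c%:P.

(* Over int this is convertible to gtrinomial; the generality in the ring lets b be an
   indeterminate, and allows reduction modulo p. *)
Definition trinc (n : nat) b c : R := (trinom b c ^+ n)`_n.

Definition trinc_sum (n : nat) b c : R :=
  \sum_(0 <= k < n) (8 * c * k%:R + 4 * c + b) * trinc k b (c ^+ 2) ^+ 2
                      * (b - 2 * c) ^+ (2 * (n - 1 - k)).

Lemma coef_trinomM b c (y : {poly R}) i :
  (trinom b c * y)`_i.+2 = y`_i + b * y`_i.+1 + c * y`_i.+2.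
Proof.
by rewrite /trinom !mulrDl !coefD coefXnM -mulrA !coefCM coefXM /= subn2.
Qed.

Lemma deriv_trinomX b c n :
  trinom b c * (trinom b c ^+ n)^`() = ('X *+ 2 + b%:P) * trinom b c ^+ n *+ n.
Proof.
have Dq : (trinom b c)^`() = 'X *+ 2 + b%:P.
  by rewrite /trinom !derivD derivXn derivM derivX !derivC mul0r add0r mulr1 addr0.
rewrite deriv_exp Dq; case: n => [|n]; first by rewrite !mulr0n mulr0.
by rewrite exprS mulrnAr mulrCA.
Qed.

Lemma coef_trinomX_rec b c n i :
  i%:R * (trinom b c ^+ n)`_i + b * i.+1%:R * (trinom b c ^+ n)`_i.+1
    + c * i.+2%:R * (trinom b c ^+ n)`_i.+2
  = n%:R * (2 * (trinom b c ^+ n)`_i + b * (trinom b c ^+ n)`_i.+1).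
Proof.
have := deriv_trinomX b c n; move: (trinom b c ^+ n) => y.
have coefXD j : ('X * y^`())`_j = j%:R * y`_j.
  by rewrite coefXM; case: j => [|j]; rewrite ?mul0r // coef_deriv mulr_natl.
(* The extra factor X turns y' into X y', whose coefficient of X^j is j y_j for every j. *)
move/(congr1 (fun z : {poly R} => ('X * z)`_i.+2)).
rewrite mulrCA coef_trinomM !coefXD => E.
rewrite [LHS](_ : _ = i%:R * y`_i + b * (i.+1%:R * y`_i.+1)
                      + c * (i.+2%:R * y`_i.+2)); last by ring.
rewrite E coefXM /= coefMn mulrDl coefD coefCM [_ *+ 2 * y]mulrnAl coefMn coefXM /=.
by rewrite mulr_natl [2 * _]mulr_natl.
Qed.

Lemma trinc0 b c : trinc 0 b c = 1.
Proof. by rewrite /trinc expr0 coef1. Qed.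

Lemma trinc_sumS n b c :
  trinc_sum n.+1 b c = (b - 2 * c) ^+ 2 * trinc_sum n b c
                       + (8 * c * n%:R + 4 * c + b) * trinc n b (c ^+ 2) ^+ 2.
Proof.
rewrite /trinc_sum big_nat_recr //= subn1 subnn muln0 expr0 mulr1; congr (_ + _).
rewrite mulr_sumr; apply: eq_big_nat => k /andP[_ lt_kn].
rewrite [RHS]mulrCA -exprD; congr (_ * _ ^+ _).
by case: n lt_kn => // n lt_kn; rewrite !subn1 -mulnS -subSn.
Qed.

End Trinomial.

(** * First-order recurrences and the closed form *)

Section CharacteristicZero.
Variables (R : idomainType) (char0 : [pchar R] =i pred0).
Implicit Types b c : R.

Definition trinc_succ (n : nat) b c : R := (trinom b c ^+ n)`_n.+1.

Let natS_neq0 n : n.+1%:R != 0 :> R.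
Proof. by move/pcharf0P: char0 => ->. Qed.

(** From X^2 q(c/X) = c q(X) comes the symmetry [X^(m-j)] q^m = c^j [X^(m+j)] q^m; this is j = 1, m
    = n + 1. In the coefficient recurrence at i = n the middle terms cancel, leaving n + 2 times the
    claim. *)
Lemma trinomX_coef_sym b c n :
  (trinom b c ^+ n.+1)`_n = c * (trinom b c ^+ n.+1)`_n.+2.
Proof.
apply: (mulfI (natS_neq0 n.+1)); have := coef_trinomX_rec b c n.+1 n.
set u := _`_n; set v := _`_n.+1; set w := _`_n.+2 => E.
(* A difference of two equal terms is added and [E] rewrites only one of them, so that [ring] proves
   the claim modulo [E]. *)
by rewrite -[RHS]addr0 -(subrr (n%:R * u + b * n.+1%:R * v + c * n.+2%:R * w)) {1}E; ring.
Qed.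

(** Expanding q q^n gives [X^(n-1)] q^n + b T_n + c B_n, and by symmetry the first term is again c
    B_n. *)
Lemma trincS n b c : trinc n.+1 b c = b * trinc n b c + 2 * c * trinc_succ n b c.
Proof.
rewrite /trinc /trinc_succ; case: n => [|n].
  rewrite expr1 !expr0 /trinom !coef1 !coefD coefXn coefCM coefX coefC /=; ring.
by rewrite exprS coef_trinomM trinomX_coef_sym; ring.
Qed.

(** Expanding q q^n brings in [X^(n+2)] q^n, which the coefficient recurrence at i = n eliminates
    once multiplied by (n + 2) c. *)
Lemma trinc_succS n b c :
  n.+2%:R * trinc_succ n.+1 b c = n.+1%:R * (b * trinc_succ n b c + 2 * trinc n b c).
Proof.
rewrite /trinc /trinc_succ [in LHS]exprS coef_trinomM.
have := coef_trinomX_rec b c n n.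
set u := _`_n; set v := _`_n.+1; set w := _`_n.+2 => E.
by rewrite -[LHS]addr0 -(subrr (n%:R * u + b * n.+1%:R * v + c * n.+2%:R * w)) {1}E; ring.
Qed.

Lemma mul_trinc_sum n b c :
  b * trinc_sum n.+1 b c
  = n.+1%:R * (2 * b * c * n.+1%:R
                 * (c * trinc_succ n b (c ^+ 2) - trinc n b (c ^+ 2)) ^+ 2
               + (b + 2 * c) * trinc n.+1 b (c ^+ 2) * trinc n b (c ^+ 2)).
Proof.
elim: n => [|n IHn].
  rewrite trinc_sumS /trinc_sum big_geq // trincS trinc0 /trinc_succ expr0 coef1 /=.
  ring.
rewrite trinc_sumS mulrDr mulrCA IHn.
move: (trinc_succS n b (c ^+ 2)) => E.
rewrite (trincS n.+1).
(* With T_(n+2) expanded, B_(n+1) is made to occur only in the product (n + 2) B_(n+1), so that [E]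
   applies without division. *)
rewrite [RHS](_ : _
  = 2 * b * c * (c * (n.+2%:R * trinc_succ n.+1 b (c ^+ 2))
                 - n.+2%:R * trinc n.+1 b (c ^+ 2)) ^+ 2
  + (b + 2 * c) * (n.+2%:R * b * trinc n.+1 b (c ^+ 2)
     + 2 * c ^+ 2 * (n.+2%:R * trinc_succ n.+1 b (c ^+ 2))) * trinc n.+1 b (c ^+ 2)).
  by rewrite E trincS; ring.
by ring.
Qed.

End CharacteristicZero.

(** * Change of rings and divisibility by n *)

Lemma rmorph_trinc (R S : comNzRingType) (f : {rmorphism R -> S}) n b c :
  f (trinc n b c) = trinc n (f b) (f c).
Proof.
by rewrite /trinc -coef_map rmorphXn /trinom !rmorphD rmorphM /= map_polyXn !map_polyC map_polyX.
Qed.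

Lemma rmorph_trinc_sum (R S : comNzRingType) (f : {rmorphism R -> S}) n b c :
  f (trinc_sum n b c) = trinc_sum n (f b) (f c).
Proof.
rewrite /trinc_sum rmorph_sum; apply: eq_bigr => k _.
by rewrite !(rmorphXn, rmorph_trinc, rmorph_nat, rmorphM, rmorphB, rmorphD).
Qed.

(** An integer b may share factors with n and cannot simply be cancelled from b S_n. For an
    indeterminate b, multiplication by it only shifts coefficients, so n divides every coefficient
    of S_n, hence its value at any integer. *)
Lemma dvdz_trinc_sum n (b c : int) : (n%:Z %| trinc_sum n b c)%Z.
Proof.
case: n => [|n]; first by rewrite /trinc_sum big_geq.
pose S := trinc_sum n.+1 ('X : {poly int}) c%:P.
have char0 : [pchar {poly int}] =i pred0 by move=> p; rewrite pchar_poly pchar_num.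
have := mul_trinc_sum char0 n 'X c%:P; rewrite -/S.
set Z := _ + _ * trinc n _ _ => E.
have -> : trinc_sum n.+1 b c = S.[b].
  by rewrite -horner_evalE rmorph_trinc_sum /= !horner_evalE hornerX hornerC.
have dvdS i : (n.+1%:Z %| S`_i)%Z.
  have := congr1 (fun q : {poly int} => q`_i.+1) E.
  by rewrite coefXM /= => ->; rewrite mulr_natl coefMn -mulr_natl natz dvdz_mulr.
by rewrite horner_coef; apply: rpred_sum => i _; apply: dvdz_mulr.
Qed.

(** * Power sums over a finite field *)

Section PowerSums.
Variable F : finFieldType.

Lemma expf_card_pred (x : F) : x != 0 -> x ^+ #|F|.-1 = 1.
Proof.
move=> nz_x; apply: (mulfI nz_x); rewrite -exprS mulr1 prednK ?expf_card //.
exact: ltnW (finNzRing_gt1 F).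
Qed.

Lemma sum_expf_eq0 k : (k < #|F|.-1)%N -> \sum_(x : F) x ^+ k = 0.
Proof.
have F1 := finNzRing_gt1 F.
case: k => [_ | k lt_k].
  (* For k = 0, translating x by 1 shows that the sum of 1 over F vanishes. *)
  have : \sum_(x : F) x = \sum_(x : F) (1 + x) by exact: reindex_inj (addrI 1).
  rewrite big_split /= => /eqP; rewrite -subr_eq subrr => /eqP sum1; rewrite [RHS]sum1.
  by apply: eq_bigr => x _; rewrite expr0.
pose p : {poly F} := 'X^(k.+2) - 'X.
(* Otherwise X^(k+2) - X, of degree less than #|F|, would vanish on all of F. Scaling x by such a g
   then multiplies the power sum by a factor other than 1. *)
have [g nz_g gk] : exists2 g : F, g != 0 & g ^+ k.+1 != 1.
  apply/exists_inP; apply: contraT; rewrite negb_exists => /forallP allF.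
  have szp : size p = k.+3.
    by rewrite size_polyDl size_polyXn // size_polyN size_polyX.
  have nz_p : p != 0 by rewrite -size_poly_eq0 szp.
  have rts : all (root p) (enum F).
    apply/allP=> x _; rewrite rootE !hornerE subr_eq0 exprS.
    have := allF x; rewrite negb_and negbK; case: eqP => [-> | _] /=.
      by rewrite !mul0r.
    by rewrite negbK => /eqP->; rewrite mulr1.
  have := max_poly_roots nz_p rts (enum_uniq F).
  by rewrite -cardE szp ltnS leqNgt -(prednK (ltnW F1)) ltnS lt_k.
have : \sum_(x : F) x ^+ k.+1 = g ^+ k.+1 * \sum_(x : F) x ^+ k.+1.
  rewrite {1}(reindex_inj (mulfI nz_g)) mulr_sumr.
  by apply: eq_bigr => x _; rewrite exprMn.
move=> /eqP; rewrite -subr_eq0 -{1}[X in X - _]mul1r -mulrBl mulf_eq0.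
by rewrite subr_eq0 eq_sym (negPf gk) => /eqP.
Qed.

(** Compared with the vanishing sum of x^0, only the term at x = 0 changes, from 1 to 0. *)
Lemma sum_expf_card_pred : \sum_(x : F) x ^+ #|F|.-1 = -1.
Proof.
have F1 := finNzRing_gt1 F.
have N0 : (0 < #|F|.-1)%N by rewrite -ltnS prednK // ltnW.
have := sum_expf_eq0 N0; rewrite (bigD1 0) //= expr0 => sum1.
rewrite (bigD1 0) //= expr0n gtn_eqF // add0r; apply/eqP.
rewrite -addr_eq0 addrC -[X in _ == X]sum1; apply/eqP; congr (_ + _).
by apply: eq_bigr => x nz_x; rewrite expr0 expf_card_pred.
Qed.

(** With N = #|F| - 1, among the exponents from 0 to 2N only N and 2N have a nonzero power sum,
    namely -1. *)
Lemma sum_horner_finField (g : {poly F}) :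
  (size g <= (#|F|.-1).*2.+1)%N ->
  \sum_(x : F) g.[x] = - (g`_(#|F|.-1) + g`_((#|F|.-1).*2)).
Proof.
have F1 := finNzRing_gt1 F; set N := #|F|.-1 => le_g.
have N0 : (0 < N)%N by rewrite -ltnS prednK // ltnW.
(* Positivity of k matters at x = 0, where 0^0 = 1 but 0^N = 0. *)
have expfN k x : (0 < k)%N -> x ^+ (k + N) = x ^+ k :> F.
  move=> k0; have [-> | nz_x] := eqVneq x 0.
    by rewrite !expr0n addn_eq0 (gtn_eqF N0) (gtn_eqF k0).
  by rewrite exprD expf_card_pred ?mulr1.
have sumN : \sum_(x : F) x ^+ N = -1 by exact: sum_expf_card_pred.
have sum0 k : (k < N.*2)%N -> k != N -> \sum_(x : F) x ^+ k = 0.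
  move=> lt_k; rewrite neq_ltn => /orP[/sum_expf_eq0// | lt_Nk].
  rewrite (eq_bigr (fun x => x ^+ (k - N))); last first.
    by move=> x _; rewrite -[in LHS](subnK (ltnW lt_Nk)) expfN ?subn_gt0.
  by apply: sum_expf_eq0; rewrite ltn_subLR ?(ltnW lt_Nk) // addnn.
under eq_bigr do rewrite (horner_coef_wide _ le_g).
rewrite exchange_big /=; under eq_bigr do rewrite -mulr_sumr.
rewrite big_ord_recr /= -addnn; under [X in _ * X]eq_bigr do rewrite expfN //.
have ltN : (N < N + N)%N by rewrite -addn1 leq_add2l.
rewrite sumN (bigD1 (Ordinal ltN)) //= sumN big1 => [|i ne_i].
  by rewrite addr0 !mulrN1 opprD.
by rewrite sum0 ?mulr0 // -addnn.
Qed.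

End PowerSums.

(** * T_(p-1) and T_p in characteristic p *)

Lemma trinom_monic_size (R : comNzRingType) (b c : R) :
  trinom b c \is monic /\ size (trinom b c) = 3.
Proof.
have szl : (size (b%:P * 'X + c%:P)%R < size ('X^2 : {poly R})%R)%N.
  rewrite size_polyXn (leq_ltn_trans (size_polyD _ _)) // gtn_max.
  rewrite (leq_ltn_trans (size_polyC_leq1 _)) // andbT mul_polyC.
  by rewrite (leq_ltn_trans (size_scale_leq _ _)) // size_polyX.
rewrite /trinom -addrA; split; last by rewrite size_polyDl // size_polyXn.
by rewrite monicE lead_coefDl // -monicE monicXn.
Qed.

Lemma trinc_card_pred (F : finFieldType) (b c : F) : 2 != 0 :> F ->
  trinc #|F|.-1 b c = #|[set y : F | y ^+ 2 == b ^+ 2 - 4 * c]|%:R - 1.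
Proof.
move=> nz2; set N := #|F|.-1; set d := b ^+ 2 - 4 * c.
have [mon_q sz_q] := trinom_monic_size b c.
have sz_qN : size (trinom b c ^+ N) = N.*2.+1.
  have := size_exp (trinom b c) N; rewrite sz_q /= mul2n => <-.
  by rewrite prednK // lt0n size_poly_eq0 monic_neq0 // monic_exp.
have lead_qN : (trinom b c ^+ N)`_(N.*2) = 1.
  by have /monicP := monic_exp N mon_q; rewrite lead_coefE sz_qN.
have N0 : (0 < N)%N by rewrite /N -ltnS prednK ?finNzRing_gt1 // ltnW ?finNzRing_gt1.
have := @sum_horner_finField F (trinom b c ^+ N).
rewrite sz_qN leqnn lead_qN => /(_ isT) sumq.
(* By Fermat, the power N detects whether y is a square root of d. *)
have indic (y : F) : (y ^+ 2 - d) ^+ N = 1 - (y \in [set y : F | y ^+ 2 == d])%:R.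
  rewrite inE -subr_eq0; case: eqP => [-> | /eqP nz].
    by rewrite expr0n gtn_eqF // subrr.
  by rewrite expf_card_pred // subr0.
have sumq2 : \sum_(x : F) (trinom b c ^+ N).[x] = - #|[set y : F | y ^+ 2 == d]|%:R.
  transitivity (\sum_(y : F) (y ^+ 2 - d) ^+ N).
    have bij : injective (fun x : F => 2 * x + b) by move=> x y /addIr /(mulfI nz2).
    rewrite [RHS](reindex_inj bij) /=; apply: eq_bigr => x _.
    rewrite horner_exp /trinom !hornerE -[LHS]mul1r.
    (* The factor 1 is written as 4^N, to use 4 q(x) = (2 x + b)^2 - d. *)
    rewrite -[X in X * _](@expf_card_pred F (2 ^+ 2)) ?expf_neq0 //.
    by rewrite -exprMn; congr (_ ^+ _); rewrite /d; ring.
  under eq_bigr do rewrite indic.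
  rewrite big_split /= sumrN (_ : \sum_(y : F) 1 = 0) ?add0r; last first.
    transitivity (\sum_(y : F) y ^+ 0); last exact: sum_expf_eq0 N0.
    by apply: eq_bigr => y _; rewrite expr0.
  congr (- _).
  by rewrite -sum1_card natr_sum [RHS]big_mkcond; apply: eq_bigr => y _; case: ifP.
by move: sumq; rewrite sumq2 => /oppr_inj ->; rewrite addrK.
Qed.

(** By Frobenius, q^p = X^(2p) + b^p X^p + c^p. *)
Lemma trinc_pchar (R : comNzRingType) p (b c : R) : p \in [pchar R] -> trinc p b c = b ^+ p.
Proof.
move=> charRp; have p0 : (0 < p)%N by apply/prime_gt0/(pcharf_prime charRp).
have charP : p \in [pchar {poly R}] by rewrite pchar_poly.
rewrite /trinc -(pFrobenius_autE charP) !pFrobenius_autD_comm; try exact: mulrC.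
rewrite !pFrobenius_autE !exprMn -!polyC_exp -exprD !coefD coefCM !coefXn coefC eqxx mulr1.
by rewrite (gtn_eqF p0) ltn_eqF ?addr0 ?add0r // -addn1 leq_add2l.
Qed.

(** * The Legendre symbol in F_p *)

Lemma intr_pchar_eq0 (R : nzRingType) p (a : int) : p \in [pchar R] ->
  (a%:~R == 0 :> R) = (p %| a)%Z.
Proof.
move=> charRp; rewrite dvdzE /= (dvdn_pcharf charRp).
by case: a => n; rewrite ?NegzE ?mulrNz ?oppr_eq0 -pmulrn ?abszN.
Qed.

Lemma card_sqrts (F : finFieldType) (a : F) : 2 != 0 :> F ->
  #|[set y : F | y ^+ 2 == a]|
  = (if a == 0%R then 1 else if [exists y : F, y ^+ 2 == a] then 2 else 0)%N.
Proof.
move=> nz2; have [-> | nz_a] := eqVneq a 0.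
  by rewrite (_ : [set _ | _] = [set 0]) ?cards1 //; apply/setP=> y; rewrite !inE sqrf_eq0.
case: existsP => [[s /eqP Ds] | no_sqrt].
  rewrite (_ : [set _ | _] = [set s; -s]); last first.
    by apply/setP=> y; rewrite !inE -Ds eqf_sqr.
  rewrite cards2 -subr_eq0 opprK -[s]mul1r -mulrDl mulf_eq0 (negPf nz2) /=.
  by move: nz_a; rewrite -Ds sqrf_eq0 => ->.
apply: eq_card0 => y; rewrite inE; apply/negP => Dy; by apply: no_sqrt; exists y.
Qed.

Lemma legendre_Fp p (a : int) : prime p ->
  (legendre a p)%:~R
  = (if a%:~R == 0 :> 'F_p then 0
     else if [exists y : 'F_p, y ^+ 2 == a%:~R] then 1 else -1) :> 'F_p.
Proof.
move=> pr_p; have charp := pchar_Fp pr_p.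
rewrite /legendre (intr_pchar_eq0 _ charp); case: ifP => // _.
rewrite (_ : [exists x : 'I_p, _] = [exists y : 'F_p, y ^+ 2 == a%:~R]).
  by case: ifP.
apply/existsP/existsP => [] [x Dx].
  exists (x%:Z)%:~R; rewrite -subr_eq0 -rmorphXn -rmorphB /= (intr_pchar_eq0 _ charp).
  by rewrite -eqz_mod_dvd.
have ltxp : (x < p)%N by rewrite -[X in (_ < X)%N](Fp_cast pr_p).
exists (Ordinal ltxp); rewrite eqz_mod_dvd -(intr_pchar_eq0 _ charp) rmorphB rmorphXn /=.
by rewrite -[_%:~R]/((x : nat)%:R) natr_Zp subr_eq0.
Qed.

(** In F_p with p odd, d has 1 + (d / p) square roots. *)
Lemma trinc_pred_Fp p (b c : int) : prime p -> odd p ->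
  (trinc p.-1 b c)%:~R = (legendre (b ^+ 2 - 4 * c) p)%:~R :> 'F_p.
Proof.
move=> pr_p odd_p; have charp := pchar_Fp pr_p.
have nz2 : 2 != 0 :> 'F_p.
  rewrite -(dvdn_pcharf charp) dvdn_prime2 //.
  by apply: contraTneq odd_p => ->.
rewrite legendre_Fp // rmorph_trinc -[X in X.-1](card_Fp pr_p) trinc_card_pred //.
rewrite rmorphB rmorphXn rmorphM /= card_sqrts //.
case: ifP => _; first by rewrite subrr.
by case: ifP => _; [rewrite mulrS addrK | rewrite sub0r].
Qed.

(** * The congruence modulo p^2, over the integers and then over the rationals *)

Lemma dvdz_trinc_sum_prime p (b c : int) : prime p -> odd p ->
  ~~ (p %| b * (b - 2 * c))%Z ->
  (p%:Z ^+ 2 %| trinc_sum p b c - (b - 2 * c) ^+ (2 * p.-1)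
                 * (p%:Z * (b + 2 * c) * legendre (b ^+ 2 - 4 * c ^+ 2) p))%Z.
Proof.
move=> pr_p odd_p ndvd; have charp := pchar_Fp pr_p.
have [nz_b nz_m] : b%:~R != 0 :> 'F_p /\ (b - 2 * c)%:~R != 0 :> 'F_p.
  by apply/andP; rewrite -negb_or -mulf_eq0 -rmorphM /= (intr_pchar_eq0 _ charp).
have char0 : [pchar int] =i pred0 by exact: pchar_num.
have p0 := prime_gt0 pr_p.
have fermat (x : 'F_p) : x != 0 -> x ^+ p.-1 = 1.
  by move=> nz_x; rewrite -[X in X.-1](card_Fp pr_p) expf_card_pred.
set M := _ ^+ (2 * p.-1); set L := legendre _ _.
(* By Fermat M = 1 modulo p; it is inserted to match the term subtracted in the goal. *)
have dvdTT : (p %| trinc p b (c ^+ 2) * trinc p.-1 b (c ^+ 2) - b * M * L)%Z.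
  rewrite -(intr_pchar_eq0 _ charp) rmorphB !rmorphM /= trinc_pred_Fp // -/L.
  rewrite rmorph_trinc (trinc_pchar _ _ charp) -[X in _ ^+ X](prednK p0) exprS.
  by rewrite fermat // /M mulnC exprM rmorphXn /= rmorphXn /= fermat // expr1n !mulr1 subrr.
(* Since b is prime to p, it can be multiplied in to reach the closed form of b S_p. *)
rewrite -(@Gauss_dvdzr _ b); last first.
  rewrite coprimezXl // coprimezE prime_coprime //.
  by move: nz_b; rewrite (intr_pchar_eq0 _ charp) dvdzE.
have := mul_trinc_sum char0 p.-1 b c; rewrite prednK // natz mulrBr => ->.
case/dvdzP: dvdTT => k /eqP; rewrite subr_eq => /eqP Dk.
(* The first term of the closed form carries p^2; the second carries one p and gets the other from
   the multiple k p in [Dk]. *)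
rewrite [X in (_ %| X)%Z](_ : _
  = (2 * b * c * (c * trinc_succ p.-1 b (c ^+ 2) - trinc p.-1 b (c ^+ 2)) ^+ 2
     + (b + 2 * c) * k) * p%:Z ^+ 2); first exact: dvdz_mull.
rewrite -[(b + 2 * c) * _ * _]mulrA Dk; ring.
Qed.

(** With r = (x - y) / p^e, the product M r is the integer z, so the denominator of r divides M and
    is prime to p. *)
Lemma rat_congr_frac p e (x y : rat) (z M : int) : (0 < p)%N -> coprimez M p ->
  M%:~R * (x - y) = (z * p%:Z ^+ e)%:~R -> rat_congr p e x y.
Proof.
move=> p0 copM E; rewrite /rat_congr; set r := _ / _.
have nz_pe : (p ^ e)%:R != 0 :> rat by rewrite pnatr_eq0 -lt0n expn_gt0 p0.
have Dr : M%:~R * r = z%:~R.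
  rewrite /r mulrA E rmorphM rmorphXn /= natrX -[(p%:Z)%:~R]/(p%:R) mulfK //.
  by rewrite -natrX.
apply: coprime_dvdl copM; rewrite -dvdzE -(@Gauss_dvdzr _ (numq r)); last first.
  by rewrite coprimezE coprime_sym coprime_num_den.
suff -> : numq r * M = z * denq r by apply: dvdz_mull.
apply: (@intr_inj rat); rewrite !rmorphM /= -Dr mulrC -mulrA; congr (_ * _).
by rewrite -{2}[r]divq_num_den divfK // intr_eq0 denq_neq0.
Qed.

Theorem theorem1p4 (b c : int) :
  (forall n : nat, (0 < n)%N ->
     (n%:Z %| (\sum_(0 <= k < n)
                 (8 * c * k%:Z + 4 * c + b) * gtrinomial k b (c ^+ 2) ^+ 2
                   * (b - 2 * c) ^+ (2 * (n - 1 - k)))%R)%Z)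
  /\
  (forall p : nat, prime p -> odd p -> ~~ (p%:Z %| (b * (b - 2 * c))%R)%Z ->
     rat_congr p 2
       (\sum_(0 <= k < p)
          (8 * c * k%:Z + 4 * c + b)%:Q
            * ((gtrinomial k b (c ^+ 2))%:Q ^+ 2 / (b - 2 * c)%:Q ^+ (2 * k)))
       (p%:Z * (b + 2 * c) * legendre (b ^+ 2 - 4 * c ^+ 2) p)%:Q).
Proof.
have sumE n : trinc_sum n b c = \sum_(0 <= k < n)
    (8 * c * k%:Z + 4 * c + b) * gtrinomial k b (c ^+ 2) ^+ 2
      * (b - 2 * c) ^+ (2 * (n - 1 - k)).
  by apply: eq_bigr => k _; rewrite (natz k).
split=> [n _ | p pr_p odd_p ndvd]; first by rewrite -sumE dvdz_trinc_sum.
have [z Dz] := dvdzP (dvdz_trinc_sum_prime pr_p odd_p ndvd).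
have ndvd_m : ~~ (p %| b - 2 * c)%Z by apply: contra ndvd; apply: dvdz_mull.
have nz_m : (b - 2 * c)%:~R != 0 :> rat.
  by rewrite intr_eq0; apply: contra ndvd_m => /eqP->; rewrite dvdz0.
(* This power of b - 2c clears all denominators, as k is at most p - 1. *)
apply: (@rat_congr_frac _ _ _ _ z ((b - 2 * c) ^+ (2 * p.-1))).
- exact: prime_gt0.
- by rewrite coprimezXl // coprimez_sym coprimezE prime_coprime // -dvdzE.
rewrite -Dz [RHS]rmorphB mulrBr; congr (_ - _); last by rewrite [RHS]rmorphM.
rewrite sumE rmorph_sum mulr_sumr; apply: eq_big_nat => k /andP[_ ltkp].
have -> : (2 * p.-1 = 2 * (p - 1 - k) + 2 * k)%N.
  by rewrite -mulnDr subn1 subnK // -ltnS prednK // prime_gt0.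
move: (b - 2 * c) (8 * c * _ + _ + _) nz_m => m a nz_m.
by rewrite !(rmorphM, rmorphXn) /= exprD; field; rewrite expf_neq0.
Qed.
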